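(* Let $n>1$ be a natural number, and let $M$ be a pointed metric space with at least $2^n$ distinct points. Then there exists a linear subspace of $\mathrm{Lip}_0(M)$ which consists entirely of strongly norm-attaining functionals (i.e. is contained in $\mathrm{SNA}(M)$) and which is isometrically isomorphic to $\ell_1^n$.
   Context: All vector spaces are real. A pointed metric space $(M,\rho)$ is a metric space with at least 2 points and a distinguished point $0\in M$. $\mathrm{Lip}_0(M)$ is the Banach space of all Lipschitz functions $f:M\to\mathbb{R}$ with $f(0)=0$, normed by the Lipschitz constant $\|f\|=\sup\{|f(x)-f(y)|/\rho(x,y): x,y\in M,\ x\neq y\}$. A function $f\in\mathrm{Lip}_0(M)$ attains its norm strongly if there are $x\neq y$ in $M$ with $\|f\|=|f(x)-f(y)|/\rho(x,y)$; $\mathrm{SNA}(M)\subset\mathrm{Lip}_0(M)$ is the set of all such $f$. $\ell_1^n$ is $\mathbb{R}^n$ with the norm $\|(x_1,\dots,x_n)\|_1=\sum_{k=1}^n|x_k|$. *)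

(* Defs.v *)
From HB Require Import structures.
From mathcomp Require Import all_boot all_order all_algebra.
From mathcomp Require Import all_classical all_reals all_analysis.

Set Implicit Arguments.
Unset Strict Implicit.
Unset Printing Implicit Defensive.

Import Order.TTheory GRing.Theory Num.Theory.
Import numFieldNormedType.Exports.

Local Open Scope classical_set_scope.
Local Open Scope ring_scope.

(* A pointed metric space is a [metricType R] together with an explicit base
   point [o]. *)

Section Lip0.
Context {R : realType} {M : metricType R}.
Implicit Types (o : M).

Definition lipschitz_fun (f : M -> R) :=
  exists k : R, forall x y, `|f x - f y| <= k * mdist x y.

Definition lip0_pred o : {pred M -> R} :=
  mem [set f | f o = 0 /\ lipschitz_fun f].

Lemma lip0_submod_closed o : submod_closed (lip0_pred o).
Proof.
split.
  rewrite inE; split => //; exists 0 => x y.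
  by rewrite /= subrr normr0 mul0r.
move=> a f g; rewrite !inE => -[f0 [k fk]] [g0 [l gl]]; split.
  by rewrite /= -[(a *: f + g) o]/(a * f o + g o) f0 g0 mulr0 addr0.
exists (`|a| * k + l) => x y.
have -> : (a *: f + g) x - (a *: f + g) y = a * (f x - f y) + (g x - g y).
  rewrite -[(a *: f + g) x]/(a * f x + g x) -[(a *: f + g) y]/(a * f y + g y).
  by rewrite mulrBr opprD addrACA.
rewrite (le_trans (ler_normD _ _))// mulrDl lerD// normrM -mulrA.
by rewrite ler_wpM2l.
Qed.

HB.instance Definition _ o :=
  GRing.isSubmodClosed.Build _ _ (lip0_pred o) (lip0_submod_closed o).

(* The carrier of the space Lip_0 of the pointed metric space (M, o). *)
Record lip0 o : Type := Lip0 {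
  lip0_fun :> M -> R ;
  lip0_funP : lip0_fun \in lip0_pred o }.

HB.instance Definition _ o := [isSub for @lip0_fun o].
HB.instance Definition _ o := [Choice of lip0 o by <:].
HB.instance Definition _ o := [SubChoice_isSubLmodule of lip0 o by <:].

Definition slopes (f : M -> R) : set R :=
  [set s | exists x y, x != y /\ s = `|f x - f y| / mdist x y].

Definition lipnorm (f : M -> R) : R := sup (slopes f).

Section norm_theory.
Variable o : M.
Implicit Types f g : lip0 o.

Lemma lip0_base f : f o = 0.
Proof. by have := lip0_funP f; rewrite inE => -[]. Qed.

Lemma lip0_slopes_ub f : has_ubound (slopes f).
Proof.
have := lip0_funP f; rewrite inE => -[_ [k fk]].
by exists k => _ [x [y [xy ->]]]; rewrite ler_pdivrMr// mdist_gt0.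
Qed.

Lemma lipnorm_ge0 f : 0 <= lipnorm f.
Proof.
have [f0|/set0P[s fs]] := eqVneq (slopes f) set0; first by rewrite /lipnorm f0 sup0.
apply: le_trans (ub_le_sup (lip0_slopes_ub f) fs).
by have [x [y [xy ->]]] := fs; rewrite divr_ge0// mdist_ge0.
Qed.

Lemma le_lipnorm f x y : `|f x - f y| <= lipnorm f * mdist x y.
Proof.
have [->|xy] := eqVneq x y; first by rewrite subrr normr0 mdistxx mulr0.
rewrite -ler_pdivrMr ?mdist_gt0//; apply: ub_le_sup; first exact: lip0_slopes_ub.
by exists x, y.
Qed.

Lemma lipnorm_le f k : 0 <= k ->
  (forall x y, `|f x - f y| <= k * mdist x y) -> lipnorm f <= k.
Proof.
move=> k0 fk.
have [f0|/set0P ne] := eqVneq (slopes f) set0; first by rewrite /lipnorm f0 sup0.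
by apply: ge_sup => // _ [x [y [xy ->]]]; rewrite ler_pdivrMr ?mdist_gt0.
Qed.

Lemma lipnormD f g : lipnorm (f + g : lip0 o) <= lipnorm f + lipnorm g.
Proof.
apply: lipnorm_le => [|x y]; first by rewrite addr_ge0 ?lipnorm_ge0.
rewrite -[(f + g : lip0 o) x]/(f x + g x) -[(f + g : lip0 o) y]/(f y + g y).
by rewrite opprD addrACA (le_trans (ler_normD _ _))// mulrDl lerD ?le_lipnorm.
Qed.

Lemma lipnormZ_le (a : R) f : lipnorm (a *: f : lip0 o) <= `|a| * lipnorm f.
Proof.
apply: lipnorm_le => [|x y]; first exact: mulr_ge0 (normr_ge0 _) (lipnorm_ge0 _).
rewrite -[(a *: f : lip0 o) x]/(a * f x) -[(a *: f : lip0 o) y]/(a * f y).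
by rewrite -mulrBr normrM -mulrA ler_wpM2l// le_lipnorm.
Qed.

Lemma lipnormZ (a : R) f : lipnorm (a *: f : lip0 o) = `|a| * lipnorm f.
Proof.
apply/le_anti; rewrite lipnormZ_le andTb.
have [->|a0] := eqVneq a 0; first by rewrite normr0 mul0r lipnorm_ge0.
rewrite -ler_pdivlMl ?normr_gt0// -normfV.
by rewrite -{1}[f](scalerK a0) lipnormZ_le.
Qed.

Lemma lipnorm0_eq0 f : lipnorm f = 0 -> f = 0.
Proof.
move=> f0; apply/val_inj/funext => x /=.
have := le_lipnorm f x o.
by rewrite f0 mul0r lip0_base subr0 normr_le0 => /eqP.
Qed.

End norm_theory.

HB.instance Definition _ o :=
  @Lmodule_isNormed.Build R (lip0 o) (fun f => lipnorm f)
    (@lipnormD o) (@lipnormZ o) (@lipnorm0_eq0 o).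

Lemma lip0_normE o (f : lip0 o) : `|f| = sup (slopes f).
Proof. by []. Qed.

Definition SNA o : set (lip0 o) :=
  [set f : lip0 o | exists x y : M, x != y /\ `|f| = `|f x - f y| / mdist x y].

End Lip0.
Arguments lip0 {R} M o.
Arguments SNA {R} M o.

(* R^n under an alias: the norm of the library on ['rV[R]_n] is the sup norm. *)
Definition ell1 (R : realType) (n : nat) : Type := 'rV[R]_n.

Section ell1.
Context {R : realType} {n : nat}.

HB.instance Definition _ := GRing.Lmodule.on (ell1 R n).

Definition norm1 (v : ell1 R n) : R := \sum_(i < n) `|(v : 'rV[R]_n) ord0 i|.

Lemma norm1D (u v : ell1 R n) : norm1 (u + v) <= norm1 u + norm1 v.
Proof.
by rewrite /norm1 -big_split/= ler_sum// => i _; rewrite mxE ler_normD.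
Qed.

Lemma norm1Z (a : R) (v : ell1 R n) : norm1 (a *: v) = `|a| * norm1 v.
Proof.
by rewrite /norm1 mulr_sumr; apply: eq_bigr => i _; rewrite mxE normrM.
Qed.

Lemma norm10_eq0 (v : ell1 R n) : norm1 v = 0 -> v = 0.
Proof.
move=> /eqP; rewrite /norm1 psumr_eq0// => /allP v0.
apply/matrixP => i j; rewrite ord1 mxE; apply/eqP.
by have := v0 j; rewrite mem_index_enum normr_eq0; apply.
Qed.

HB.instance Definition _ :=
  @Lmodule_isNormed.Build R (ell1 R n) norm1 norm1D norm1Z norm10_eq0.

Lemma ell1_normE (v : ell1 R n) : `|v| = \sum_(i < n) `|(v : 'rV[R]_n) ord0 i|.
Proof. by []. Qed.

End ell1.

(* [V], a linear subspace of [F] with the inherited norm, is isometrically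
   isomorphic to [E]. *)
Definition isometrically_isomorphic (R : realType) (F E : normedModType R)
    (V : {pred F}) : Prop :=
  exists T : {linear E -> F},
    set_bij [set: E] [set` V] T /\ (forall u, `|T u| = `|u|).
Arguments isometrically_isomorphic {R F} E V.

(* Main.v *)
Require Import Defs.
From HB Require Import structures.
From mathcomp Require Import all_boot all_order all_algebra all_fingroup.
From mathcomp Require Import all_classical all_reals all_analysis.
From mathcomp Require Import lra.

(** It suffices to find 1-Lipschitz functions [F_1, ..., F_n] and, for every sign
vector [t] up to a global sign, a pair of points [x != y] such that
[F_i x - F_i y = t_i * mdist x y] for all [i] at once. Indeed the combination
[\sum_i v_i F_i] has Lipschitz constant at most [\sum_i |v_i|], and the pair
belonging to the signs of [v] has exactly that slope: [v |-> \sum_i v_i F_i] is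
therefore an isometry defined on [ell_1^n], and all its values attain their norm
strongly.

There are [2^(n-1)] sign vectors up to a global sign, hence as many pairs, and
[2^n] points are enough to make these pairs disjoint. The pairs have to be
chosen so that, whatever orientation [(a_k, b_k)] is given to each of them, some
1-Lipschitz [f] satisfies [f a_k - f b_k = mdist a_k b_k] for all [k]. A perfect
matching of minimal total length has this property
([exists_minimal_matching]): reassigning the [b_k] along a permutation gives
another perfect matching of the same points, so that
[\sum_k mdist a_k b_k <= \sum_k mdist a_k b_(s k)] for every permutation [s].
As in the Kantorovich duality of optimal transport, this cyclic monotonicity
yields a potential: with the costs [c k l = mdist a_k b_l - mdist a_k b_k] no
cycle is negative, so that shortest path lengths [u] are well behaved and satisfy
[u_k <= u_l + c k l] ([exists_potential]); the function
[f x = min_k (u_k + mdist x b_k)] is then as required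
([exists_lipschitz_calibrated]). *)

Set Implicit Arguments.
Unset Strict Implicit.
Unset Printing Implicit Defensive.

Import Order.TTheory GRing.Theory Num.Theory.

Local Open Scope classical_set_scope.
Local Open Scope ring_scope.

(** * Potentials of costs without negative cycles *)

Section potentials.
Context {R : realDomainType} {K : finType}.
Variable c : K -> K -> R.

Definition path_cost x p := \sum_(w <- pairmap c x p) w.

Lemma path_cost_cons x y p : path_cost x (y :: p) = c x y + path_cost y p.
Proof. by rewrite /path_cost /= big_cons. Qed.

Lemma path_cost_cat x p q :
  path_cost x (p ++ q) = path_cost x p + path_cost (last x p) q.
Proof. by rewrite /path_cost pairmap_cat big_cat. Qed.

(** Rewriting a cycle as the graph of [next] is what lets the hypothesis on
permutations, [perm_cost_ge0], speak about closed paths. *)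
Lemma cycle_cost x p : uniq (x :: p) ->
  path_cost x (rcons p x) = \sum_(y <- x :: p) c y (next (x :: p) y).
Proof.
move=> xp_uniq.
rewrite /path_cost -(big_map (fun y => c y (next (x :: p) y)) xpredT id).
congr bigop; apply: (@eq_from_nth _ 0).
  by rewrite size_pairmap size_rcons size_map.
move=> i; rewrite size_pairmap size_rcons => i_lt.
rewrite (nth_pairmap x) ?size_rcons// (nth_map x)//.
rewrite next_nth mem_nth// index_uniq// -rcons_cons nth_rcons/= i_lt.
congr (c _ _); rewrite nth_rcons; case: ltnP => // p_le_i.
by rewrite (nth_default _ p_le_i) if_same.
Qed.

Hypothesis cxx : forall x, c x x = 0.
Hypothesis perm_cost_ge0 : forall s : {perm K}, 0 <= \sum_x c x (s x).

(** The cycle is extended to a permutation by fixed points, which cost nothing. *)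
Lemma cycle_cost_ge0 x p : uniq (x :: p) -> 0 <= path_cost x (rcons p x).
Proof.
move=> xp_uniq; rewrite cycle_cost// big_uniq//=.
have := perm_cost_ge0 (perm (can_inj (prev_next xp_uniq))).
rewrite (bigID (mem (x :: p)))/= [X in _ + X]big1 ?addr0 => [|y yNp].
  by under eq_bigr do rewrite permE.
by rewrite permE next_nth (negbTE yNp) cxx.
Qed.

(** Restricting to paths without repetition leaves only finitely many of them. *)
Lemma optimal_path x : exists p,
  uniq (x :: p) /\ forall q, uniq (x :: q) -> path_cost x p <= path_cost x q.
Proof.
have [|p p_uniq p_min] := @arg_minP _ _ (#|K|.-bseq K) [bseq]
  (fun p => uniq (x :: p)) (path_cost x); first by [].
exists p; split => // q q_uniq.
have q_size : (size q <= #|K|)%N.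
  by move: q_uniq => /= /andP[_ /card_uniqP <-]; exact: max_card.
exact: (p_min (Bseq q_size)).
Qed.

(** The potential of [x] is the least cost of a simple path starting at [x], with
a free end. Prefixing the edge from [x] to [y] to an optimal path of [y] gives a
path from [x]; if it meets [x] again, the closed part can be dropped since its
cost is nonnegative. *)
Lemma exists_potential : exists u : K -> R, forall x y, u x <= u y + c x y.
Proof.
have [P P_opt] := choice optimal_path.
exists (fun x => path_cost x (P x)) => x y.
have [y_uniq _] := P_opt y; have [_ x_min] := P_opt x.
have [->|xy] := eqVneq x y; first by rewrite cxx addr0.
have [x_in|xNin] := boolP (x \in P y); last first.
  rewrite addrC -path_cost_cons; apply: x_min.
  by rewrite [uniq _]/= inE negb_or xy xNin.
(* The optimal path of [y] is [p], then [x], then [q]; [x :: y :: p] closes up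
   to a cycle, and [q] competes with the optimal path of [x]. *)
case/splitPr: x_in y_uniq => p q y_uniq.
rewrite -cat_rcons path_cost_cat last_rcons.
move: y_uniq; rewrite -cat_cons cat_uniq => /and3P[yp_uniq /norP[xNyp _]].
move=> /x_min; have : 0 <= path_cost x (rcons (y :: p) x).
  by apply: cycle_cost_ge0; rewrite cons_uniq xNyp.
rewrite rcons_cons path_cost_cons; lra.
Qed.

End potentials.

(** * Lipschitz functions calibrated by a matching *)

Section metric.
Context {R : realType} {M : metricType R}.

(** Each [u k + mdist x (b k)] is 1-Lipschitz in [x], hence so is the minimum
[f]. Since [f (b k) <= u k] by definition, only the inequality
[f (a k) >= u k + mdist (a k) (b k)] is at stake, and that is the inequality
satisfied by the potential. The index
[k0] makes the minimum range over a nonempty set. *)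
Lemma exists_lipschitz_calibrated (K : finType) (a b : K -> M) (k0 : K) :
    (forall s : {perm K},
      \sum_k mdist (a k) (b k) <= \sum_k mdist (a k) (b (s k))) ->
  exists f : M -> R, (forall x y, `|f x - f y| <= mdist x y) /\
    forall k, f (a k) - f (b k) = mdist (a k) (b k).
Proof.
move=> ab_min.
have [|s|u u_le] :=
  @exists_potential R K (fun k l => mdist (a k) (b l) - mdist (a k) (b k)).
- by move=> k; rewrite subrr.
- by rewrite sumrB subr_ge0.
pose g k x := u k + mdist x (b k).
have /choice[m m_min] x : exists m, forall k, g m x <= g k x.
  have [//|m _ m_le] := @arg_minP _ _ K k0 xpredT (g^~ x).
  by exists m => k; exact: m_le.
pose f x := g (m x) x.
have f_le x y : f x - f y <= mdist x y.
  have := m_min x (m y); have := metric_triangle x y (b (m y)).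
  by rewrite /f /g; lra.
have f_lip x y : `|f x - f y| <= mdist x y.
  by rewrite ler_norml f_le lerNl opprB metric_sym f_le.
exists f; split => // k; apply/eqP; rewrite eq_le f_le /=.
have := m_min (b k) k; have := u_le k (m (a k)).
by rewrite /f /g mdistxx; lra.
Qed.

(** Matchings are encoded by permutations of [K * bool], the pair [k] joining
the images of [(k, true)] and [(k, false)]. The orientation [t] selects the
endpoint called [a_k]; minimality does not depend on it because the distance is
symmetric, and this is why the inequality holds for all orientations at once. *)
Lemma exists_minimal_matching (K : finType) (P : K * bool -> M) :
    injective P ->
  exists2 p : K * bool -> M, injective p &
    forall (t : K -> bool) (s : {perm K}),
      \sum_k mdist (p (k, t k)) (p (k, ~~ t k)) <=
      \sum_k mdist (p (k, t k)) (p (s k, ~~ t (s k))).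
Proof.
move=> P_inj.
have [//|r _ r_min] := @arg_minP _ _ {perm K * bool} 1%g xpredT
  (fun r => \sum_k mdist (P (r (k, true))) (P (r (k, false)))).
exists (P \o r) => [|t s]; first exact: inj_comp P_inj perm_inj.
(* [q] moves the minimal matching to the one that pairs [a_k] with [b_(s k)]. *)
pose q (z : K * bool) :=
  if z.2 then (z.1, t z.1) else (s z.1, ~~ t (s z.1)).
have q_inj : injective q.
  move=> [k [] [l []]]; rewrite /q/= => -[].
  - by move=> ->.
  - by move=> -> /eqP; case: (t _).
  - by move=> <- /eqP; case: (t _).
  - by move=> /perm_inj ->.
have := r_min (perm q_inj * r)%g isT.
under [X in _ <= X]eq_bigr do rewrite !permM !permE /q/=.
apply: le_trans; rewrite le_eqVlt; apply/orP; left; apply/eqP.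
by apply: eq_bigr => k _ /=; case: (t k) => //=; rewrite metric_sym.
Qed.

(** Pairs are indexed by the signs of the coordinates [1, ..., m] relative to
that of the coordinate [0]. The [i]-th function is calibrated for the orientation
of the pairs given by the [i]-th relative sign; a global change of sign of [t] is
absorbed by exchanging [x] and [y]. *)
Lemma exists_sign_functions (o : M) (m : nat) :
    (`I_(2 ^ m.+1) #<= [set: M])%card ->
  exists F : 'I_m.+1 -> lip0 M o,
    (forall i x y, `|F i x - F i y| <= mdist x y) /\
    forall t : 'I_m.+1 -> bool, exists x y : M, x != y /\
      forall i, F i x - F i y = (-1) ^+ t i * mdist x y.
Proof.
move=> cardM.
pose K := {ffun 'I_m -> bool}.
have [P P_inj] : exists P : K * bool -> M, injective P.
  have /card_leP[g] := cardM.
  have card_K : #|{: K * bool}| = (2 ^ m.+1)%N.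
    by rewrite card_prod card_ffun card_ord card_bool expnSr.
  have rank_lt (z : K * bool) : (enum_rank z < 2 ^ m.+1)%N.
    by rewrite -card_K ltn_ord.
  have rank_in (z : K * bool) : (enum_rank z : nat) \in `I_(2 ^ m.+1).
    exact/mem_set/rank_lt.
  pose h z : `I_(2 ^ m.+1) := SigSub (rank_in z).
  exists (fun z => val (g (h z))) => z1 z2 /val_inj/inj.
  rewrite !in_setT => /(_ isT isT)/(congr1 val)/= /val_inj.
  exact: enum_rank_inj.
have [p p_inj p_min] := exists_minimal_matching P_inj.
pose t (i : 'I_m.+1) (k : K) : bool :=
  if unlift ord0 i is Some j then k j else false.
have /choice[f f_spec] i : exists f : M -> R,
    (forall x y, `|f x - f y| <= mdist x y) /\
    forall k, f (p (k, t i k)) - f (p (k, ~~ t i k)) =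
      mdist (p (k, t i k)) (p (k, ~~ t i k)).
  exact: exists_lipschitz_calibrated [ffun=> false] (p_min _).
have f_lip0 i : (fun x => f i x - f i o) \in lip0_pred o.
  rewrite inE; split; first by rewrite subrr.
  exists 1 => x y; rewrite mul1r opprB addrA subrK.
  by have [+ _] := f_spec i; apply.
exists (fun i => Lip0 (f_lip0 i)); split => [i x y|s] /=.
  by rewrite opprB addrA subrK; have [+ _] := f_spec i; apply.
pose k : K := [ffun j => s (lift ord0 j) (+) s ord0].
exists (p (k, s ord0)), (p (k, ~~ s ord0)); split.
  by rewrite (inj_eq p_inj) xpair_eqE eqxx/=; case: (s _).
move=> i; rewrite opprB addrA subrK.
have -> : s i = s ord0 (+) t i k.
  rewrite /t; case: unliftP => [j|] ->; last by rewrite addbF.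
  by rewrite ffunE addbC addbK.
have [_ /(_ k)] := f_spec i.
have := metric_sym (p (k, true)) (p (k, false)).
by case: (t i k); case: (s ord0); rewrite /= ?expr0 ?expr1; lra.
Qed.

(** * Isometric embedding of [ell_1] *)

Lemma exists_attaining_isometry (o : M) (m : nat) :
    (`I_(2 ^ m.+1) #<= [set: M])%card ->
  exists T : {linear ell1 R m.+1 -> lip0 M o},
    (forall v, `|T v| = `|v|) /\ forall v, SNA M o (T v).
Proof.
move=> cardM.
have [F [F_lip F_sign]] := exists_sign_functions o cardM.
pose T (v : ell1 R m.+1) : lip0 M o := \sum_i (v : 'rV[R]_m.+1) ord0 i *: F i.
have T_linear : linear T.
  move=> a u v; rewrite /T scaler_sumr -big_split/=.
  by apply: eq_bigr => i _; rewrite !mxE scalerDl scalerA.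
have TE v x : T v x = \sum_i (v : 'rV[R]_m.+1) ord0 i * F i x.
  by rewrite -[LHS]/((\val (T v)) x) /T raddf_sum fct_sumE.
have TB v x y :
    T v x - T v y = \sum_i (v : 'rV[R]_m.+1) ord0 i * (F i x - F i y).
  by rewrite !TE -sumrB; apply: eq_bigr => i _; rewrite mulrBr.
have T_le v : `|T v| <= `|v|.
  apply: lipnorm_le => [|x y]; first exact: normr_ge0.
  rewrite TB ell1_normE mulr_suml (le_trans (ler_norm_sum _ _ _))//.
  by apply: ler_sum => i _; rewrite normrM ler_wpM2l.
have T_attains v : exists x y, x != y /\ `|T v x - T v y| = `|v| * mdist x y.
  have [x [y [xy Fxy]]] := F_sign (fun i => (v : 'rV[R]_m.+1) ord0 i < 0).
  exists x, y; split => //.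
  have -> : T v x - T v y = `|v| * mdist x y.
    rewrite TB ell1_normE mulr_suml; apply: eq_bigr => i _.
    by rewrite Fxy mulrA; congr (_ * _); rewrite mulrC -normrEsign.
  by rewrite ger0_norm// mulr_ge0// mdist_ge0.
have T_norm v : `|T v| = `|v|.
  apply/eqP; rewrite eq_le T_le/=.
  have [x [y [xy Txy]]] := T_attains v.
  by rewrite -(ler_pM2r (x := mdist x y)) ?mdist_gt0// -Txy le_lipnorm.
pose T_lin : {linear ell1 R m.+1 -> lip0 M o} :=
  HB.pack T (GRing.isLinear.Build _ _ _ _ T T_linear).
exists T_lin; split=> // v.
have [x [y [xy Txy]]] := T_attains v.
by exists x, y; rewrite Txy mulfK ?T_norm// gt_eqF// mdist_gt0.
Qed.

End metric.

Theorem theorem2p6 (R : realType) (M : metricType R) (o : M) (n : nat)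
    (n_gt1 : (1 < n)%N) (cardM : (`I_(2 ^ n) #<= [set: M])%card) :
  exists V : {pred lip0 M o},
    [/\ submod_closed V,
        [set` V] `<=` SNA M o
      & isometrically_isomorphic (ell1 R n) V].
Proof.
case: n n_gt1 cardM => // m _ cardM.
have [T [T_norm T_SNA]] := exists_attaining_isometry o cardM.
exists (fun f => f \in range T); split.
- split; first by apply/mem_set; exists 0 => //; rewrite linear0.
  move=> a _ _ /set_mem[u _ <-] /set_mem[v _ <-]; apply/mem_set.
  by exists (a *: u + v); rewrite ?linearP.
- by move=> _ /set_mem[v _ <-]; exact: T_SNA.
- exists T; split=> //; split => [v _|u v _ _ Tuv|_ /set_mem//].
    by apply/mem_set; exists v.
  by apply/eqP; rewrite -subr_eq0 -normr_eq0 -T_norm linearB/= Tuv subrr normr0.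
Qed.
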